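(* For every sequent $S$: $S$ is derivable in $\mathsf{G3iSL}_\Box$ if and only if $S$ is derivable in $\mathsf{G4iSL}_\Box$.
   Context: Formulas are built from the constant $\bot$, atoms (propositional variables) $p,q,r,\dots$, binary connectives $\wedge,\vee,\to$ and the unary modal operator $\Box$ (there is no $\Diamond$); $\neg\varphi$ abbreviates $\varphi\to\bot$; $\bot$ is not an atom. A sequent is an expression $\Gamma\Rightarrow\Delta$ with $\Gamma,\Delta$ finite multisets of formulas, $\Delta$ containing at most one formula. $\Gamma,\Pi$ denotes multiset union. $\Box\Gamma$ is the multiset $\{\Box\varphi\mid\varphi\in\Gamma\}$ and $\boxdot\Gamma=\Gamma\cup\Box\Gamma$ (multiset union). A formula is boxed if it has the form $\Box\psi$. Common axioms and rules (''from premises infer conclusion''): At: $\Gamma,p\Rightarrow p$ ($p$ an atom). $L\bot$: $\Gamma,\bot\Rightarrow\Delta$. $R\wedge$: from $\Gamma\Rightarrow\varphi$ and $\Gamma\Rightarrow\psi$ infer $\Gamma\Rightarrow\varphi\wedge\psi$. $L\wedge$: from $\Gamma,\varphi,\psi\Rightarrow\Delta$ infer $\Gamma,\varphi\wedge\psi\Rightarrow\Delta$. $R\vee$: from $\Gamma\Rightarrow\varphi_i$ ($i=0$ or $1$) infer $\Gamma\Rightarrow\varphi_0\vee\varphi_1$. $L\vee$: from $\Gamma,\varphi\Rightarrow\Delta$ and $\Gamma,\psi\Rightarrow\Delta$ infer $\Gamma,\varphi\vee\psi\Rightarrow\Delta$. $R{\to}$: from $\Gamma,\varphi\Rightarrow\psi$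 infer $\Gamma\Rightarrow\varphi\to\psi$. $\mathsf{G3iSL}_\Box$ consists of the common axioms and rules together with: $L{\to}$: from $\Gamma,\varphi\to\psi\Rightarrow\varphi$ and $\Gamma,\psi\Rightarrow\Delta$ infer $\Gamma,\varphi\to\psi\Rightarrow\Delta$. $\mathcal R_{\rm SL}$: from $\Pi,\boxdot\Gamma,\Box\varphi\Rightarrow\varphi$ infer $\Box\Sigma,\Pi,\Box\Gamma\Rightarrow\Box\varphi$, where $\Pi$ contains no boxed formulas. $\mathsf{G4iSL}_\Box$ consists of the common axioms and rules together with: $Lp{\to}$: from $\Gamma,p,\varphi\Rightarrow\Delta$ infer $\Gamma,p,p\to\varphi\Rightarrow\Delta$ ($p$ an atom). $L{\wedge}{\to}$: from $\Gamma,\varphi\to(\psi\to\gamma)\Rightarrow\Delta$ infer $\Gamma,\varphi\wedge\psi\to\gamma\Rightarrow\Delta$. $L{\vee}{\to}$: from $\Gamma,\varphi\to\gamma,\psi\to\gamma\Rightarrow\Delta$ infer $\Gamma,\varphi\vee\psi\to\gamma\Rightarrow\Delta$. $L{\to}{\to}$: from $\Gamma,\psi\to\gamma\Rightarrow\varphi\to\psi$ and $\Gamma,\gamma\Rightarrow\Delta$ infer $\Gamma,(\varphi\to\psi)\to\gamma\Rightarrow\Delta$. $\to_{\rm SL}$: from $\Pi,\boxdot\Gamma,\Box\varphi,\Box\varphi\to\psi\Rightarrow\varphi$ and $\Pi,\Box\Gamma,\psi\Rightarrow\Delta$ infer $\Pi,\Box\Gamma,\Box\varphi\to\psi\Rightarrow\Delta$,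 where $\Pi$ contains no boxed formulas. $\mathcal R^4_{\rm SL}$: from $\Pi,\boxdot\Gamma,\Box\varphi\Rightarrow\varphi$ infer $\Pi,\Box\Gamma\Rightarrow\Box\varphi$, where $\Pi$ contains no boxed formulas. *)

(* Defs.v *)
From Stdlib Require List.
From HB Require Import structures.
From mathcomp Require Import all_boot.
From mathcomp Require Import finmap multiset.

Set Implicit Arguments.
Unset Strict Implicit.
Unset Printing Implicit Defensive.

Local Open Scope mset_scope.

Inductive form : Type :=
| Bot
| Var of nat
| And of form & form
| Or of form & form
| Imp of form & form
| Box of form.

(* Encoding into generic trees, used only to equip [form] with the choiceType
   structure that [{mset form}] requires. *)
Fixpoint tree_of_form (phi : form) : GenTree.tree nat :=
  match phi with
  | Bot => GenTree.Node 0 [::]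
  | Var p => GenTree.Leaf p
  | And phi psi => GenTree.Node 1 [:: tree_of_form phi; tree_of_form psi]
  | Or phi psi => GenTree.Node 2 [:: tree_of_form phi; tree_of_form psi]
  | Imp phi psi => GenTree.Node 3 [:: tree_of_form phi; tree_of_form psi]
  | Box phi => GenTree.Node 4 [:: tree_of_form phi]
  end.

Fixpoint form_of_tree (t : GenTree.tree nat) : option form :=
  match t with
  | GenTree.Leaf p => Some (Var p)
  | GenTree.Node 0 [::] => Some Bot
  | GenTree.Node 1 [:: t; u] =>
      if (form_of_tree t, form_of_tree u) is (Some phi, Some psi)
      then Some (And phi psi) else None
  | GenTree.Node 2 [:: t; u] =>
      if (form_of_tree t, form_of_tree u) is (Some phi, Some psi)
      then Some (Or phi psi) else None
  | GenTree.Node 3 [:: t; u] =>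
      if (form_of_tree t, form_of_tree u) is (Some phi, Some psi)
      then Some (Imp phi psi) else None
  | GenTree.Node 4 [:: t] => omap Box (form_of_tree t)
  | _ => None
  end.

Lemma tree_of_formK : pcancel tree_of_form form_of_tree.
Proof.
by elim=> [|p|phi IH psi IH'|phi IH psi IH'|phi IH psi IH'|phi IH] //=;
  rewrite IH ?IH'.
Qed.

HB.instance Definition _ := Countable.copy form (pcan_type tree_of_formK).

Definition boxed (phi : form) : bool := if phi is Box _ then true else false.

Definition no_boxed (G : {mset form}) : Prop :=
  forall phi, phi \in G -> ~~ boxed phi.

Definition mbox (G : {mset form}) : {mset form} :=
  seq_mset [seq Box phi | phi <- G].

Definition mboxdot (G : {mset form}) : {mset form} := G `+` mbox G.

(* A multiset with at most one element is encoded as an [option]. *)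
Record sequent : Type := Sequent {
  antecedent : {mset form};
  succedent : option form
}.

Declare Scope sequent_scope.
Delimit Scope sequent_scope with seqt.
Notation "G ⇒ D" := (Sequent G%mset D) (at level 70, no associativity)
  : sequent_scope.
Local Open Scope sequent_scope.

(* [R Ps S] means that [S] follows from the list of premises [Ps] by one
   application of a rule; axioms have no premises. *)
Definition calculus : Type := seq sequent -> sequent -> Prop.

Inductive derivable (R : calculus) : sequent -> Prop :=
| derivable_by Ps S :
    R Ps S -> (forall P, List.In P Ps -> derivable R P) -> derivable R S.

Implicit Types (G Pi Sg : {mset form}) (phi psi gamma : form)
  (D : option form).

Inductive common_rule : calculus :=
| At G p :
    common_rule [::] (G `+` [mset Var p] ⇒ Some (Var p))
| LBot G D :
    common_rule [::] (G `+` [mset Bot] ⇒ D)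
| RAnd G phi psi :
    common_rule [:: G ⇒ Some phi; G ⇒ Some psi]
                (G ⇒ Some (And phi psi))
| LAnd G phi psi D :
    common_rule [:: G `+` [mset phi; psi] ⇒ D]
                (G `+` [mset And phi psi] ⇒ D)
| ROr0 G phi psi :
    common_rule [:: G ⇒ Some phi] (G ⇒ Some (Or phi psi))
| ROr1 G phi psi :
    common_rule [:: G ⇒ Some psi] (G ⇒ Some (Or phi psi))
| LOr G phi psi D :
    common_rule [:: G `+` [mset phi] ⇒ D; G `+` [mset psi] ⇒ D]
                (G `+` [mset Or phi psi] ⇒ D)
| RImp G phi psi :
    common_rule [:: G `+` [mset phi] ⇒ Some psi]
                (G ⇒ Some (Imp phi psi)).

Inductive G3iSL : calculus :=
| G3_common Ps S : common_rule Ps S -> G3iSL Ps S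
| LImp G phi psi D :
    G3iSL [:: G `+` [mset Imp phi psi] ⇒ Some phi; G `+` [mset psi] ⇒ D]
          (G `+` [mset Imp phi psi] ⇒ D)
| RSL Sg Pi G phi :
    no_boxed Pi ->
    G3iSL [:: Pi `+` mboxdot G `+` [mset Box phi] ⇒ Some phi]
          (mbox Sg `+` Pi `+` mbox G ⇒ Some (Box phi)).

Inductive G4iSL : calculus :=
| G4_common Ps S : common_rule Ps S -> G4iSL Ps S
| LVarImp G p phi D :
    G4iSL [:: G `+` [mset Var p; phi] ⇒ D]
          (G `+` [mset Var p; Imp (Var p) phi] ⇒ D)
| LAndImp G phi psi gamma D :
    G4iSL [:: G `+` [mset Imp phi (Imp psi gamma)] ⇒ D]
          (G `+` [mset Imp (And phi psi) gamma] ⇒ D)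
| LOrImp G phi psi gamma D :
    G4iSL [:: G `+` [mset Imp phi gamma; Imp psi gamma] ⇒ D]
          (G `+` [mset Imp (Or phi psi) gamma] ⇒ D)
| LImpImp G phi psi gamma D :
    G4iSL [:: G `+` [mset Imp psi gamma] ⇒ Some (Imp phi psi);
              G `+` [mset gamma] ⇒ D]
          (G `+` [mset Imp (Imp phi psi) gamma] ⇒ D)
| ImpSL Pi G phi psi D :
    no_boxed Pi ->
    G4iSL [:: Pi `+` mboxdot G `+` [mset Box phi; Imp (Box phi) psi]
                ⇒ Some phi;
              Pi `+` mbox G `+` [mset psi] ⇒ D]
          (Pi `+` mbox G `+` [mset Imp (Box phi) psi] ⇒ D)
| R4SL Pi G phi :
    no_boxed Pi ->
    G4iSL [:: Pi `+` mboxdot G `+` [mset Box phi] ⇒ Some phi]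
          (Pi `+` mbox G ⇒ Some (Box phi)).

(* Main.v *)
(* Both calculi are sound and complete for intuitionistic Kripke models with a
   conversely well-founded modal relation contained in the order, so they
   derive the same sequents. For completeness take an underivable sequent with
   antecedent [G]. If some smaller underivable sequent has only countermodels
   that also refute the given one, pass to it; otherwise glue countermodels of
   the smaller underivable sequents above a new root whose atoms are those of
   [G]. The root forces an implication of [G] because some world above it
   refutes the antecedent. "Smaller" is lexicographic: in G4iSL, first the
   number of boxed subformulas missing from the antecedent, then a weight; in
   G3iSL, first the number of subformulas that the antecedent does not cover,
   then its size. In the modal rules a box already present would make the
   premise derivable by the identity axiom, so the first component drops. *)

From Stdlib Require Import Classical IndefiniteDescription Setoid.
From mathcomp Require Import all_boot.
From mathcomp Require Import finmap multiset zify.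
Require Import Defs.

Set Implicit Arguments.
Unset Strict Implicit.
Unset Printing Implicit Defensive.

Local Open Scope mset_scope.
Local Open Scope sequent_scope.

Ltac mset_ac := by apply/msetP=> ?; rewrite !(msetE2, mset0E); lia.

(** * Multisets and boxed contexts *)

Lemma perm_msetD (A B : {mset form}) : perm_eq (A `+` B) (A ++ B).
Proof. by apply/allP=> a _ /=; rewrite count_cat !count_mem_mset msetE2. Qed.

Lemma mboxD (A B : {mset form}) : mbox (A `+` B) = mbox A `+` mbox B.
Proof.
apply/msetP=> x; rewrite msetE2 !mset_seqE -count_cat -map_cat.
by apply/permP/perm_map/perm_msetD.
Qed.

Lemma mbox1 phi : mbox [mset phi] = [mset Box phi].
Proof.
by apply/msetP=> x; rewrite mset_seqE enum_msetn /= msetnE addn0 eq_sym; case: eqP.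
Qed.

Lemma mbox0 : mbox mset0 = mset0.
Proof. by apply/msetP=> x; rewrite mset_seqE enum_mset0 mset0E. Qed.

Lemma mem_mbox (G : {mset form}) chi :
  reflect (exists2 phi, phi \in G & chi = Box phi) (chi \in mbox G).
Proof. by rewrite (perm_mem (perm_eq_seq_mset _)); apply: mapP. Qed.

Lemma mem_mset_split (G : {mset form}) phi :
  phi \in G -> exists G0, G = G0 `+` [mset phi].
Proof. by move=> Gphi; exists (G `\ phi); rewrite msetDC msetB1K. Qed.

(** The modal rules act on contexts of this shape, so an arbitrary antecedent is split this way
    before one of them is applied. *)
Lemma box_split (G : {mset form}) :
  exists Pi Gm, no_boxed Pi /\ G = Pi `+` mbox Gm.
Proof.
rewrite -(seq_mset_id G); elim: (G : seq form) => [|phi s [Pi [Gm [Pi_nb eq_s]]]].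
  exists mset0, mset0; split=> [psi|]; first by rewrite in_mset0.
  by rewrite mbox0 msetD0; apply/msetP=> x; rewrite mset_seqE mset0E.
have eq_cons : seq_mset (phi :: s) = phi +` seq_mset s.
  by apply/msetP=> x; rewrite mset1DE !mset_seqE /= eq_sym.
rewrite eq_cons eq_s; case phiB: (boxed phi).
  case: phi phiB {eq_cons} => // chi _; exists Pi, (chi +` Gm); split=> //.
  by rewrite mboxD mbox1 msetDCA.
exists (phi +` Pi), Gm; split; last by rewrite msetDA.
by move=> psi; rewrite in_mset1D => /orP[/eqP->|/Pi_nb]; rewrite ?phiB.
Qed.

(** * Kripke models *)

(* A tree is a rooted Kripke model whose worlds are its subtrees: [le] is the
   subtree relation and [acc] asks for a path through a strong edge. *)
Inductive tree : Type :=
| Node (J : Type) (atoms : nat -> Prop) (strong : J -> bool) (child : J -> tree).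

Definition label (t : tree) : nat -> Prop := let: Node _ v _ _ := t in v.

Fixpoint le (s t : tree) : Prop :=
  s = t \/ let: Node J _ _ c := s in exists i : J, le (c i) t.

Fixpoint acc (s t : tree) : Prop :=
  let: Node J _ e c := s in
  exists i : J, e i /\ le (c i) t \/ acc (c i) t.

(* Quantifying over [le] in the atomic case makes forcing persistent without
   any condition on the labels. *)
Fixpoint forces (t : tree) (phi : form) : Prop :=
  match phi with
  | Bot => False
  | Var p => forall u, le t u -> label u p
  | And a b => forces t a /\ forces t b
  | Or a b => forces t a \/ forces t b
  | Imp a b => forall u, le t u -> forces u a -> forces u b
  | Box a => forall u, acc t u -> forces u a
  end.

Lemma le_refl t : le t t.
Proof. by case: t => *; left. Qed.

Lemma le_trans s t u : le s t -> le t u -> le s u.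
Proof.
elim: s => J v e c IH [<- //|[i le_t] le_u]; right; exists i; exact: IH le_u.
Qed.

Lemma le_acc s t u : le s t -> acc t u -> acc s u.
Proof.
elim: s => J v e c IH [<- //|[i le_t] acc_u] /=; exists i; right; exact: IH acc_u.
Qed.

Lemma acc_le s t : acc s t -> le s t.
Proof.
by elim: s => J v e c IH [i [[_ le_t]|/IH le_t]]; right; exists i.
Qed.

(** Each [acc] step descends to a proper subtree of an inductive tree. The claim is strengthened to
    all worlds of a tree so that the induction on trees goes through. *)
Lemma acc_wf : well_founded (fun t s => acc s t).
Proof.
suff wf s t : le s t -> Acc (fun t s => acc s t) t.
  by move=> t; apply: wf (le_refl t).
elim: s t => J v e c IH t [<-|[i /IH //]]; constructor=> u.
by move=> [i [[_ /IH//]|/acc_le/IH]].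
Qed.

Lemma forces_le t u phi : le t u -> forces t phi -> forces u phi.
Proof.
move=> le_tu; elim: phi => //=.
- by move=> p Hp w /(le_trans le_tu)/Hp.
- by move=> a IHa b IHb [/IHa ? /IHb].
- by move=> a IHa b IHb [/IHa|/IHb]; [left|right].
- by move=> a _ b _ Hab w /(le_trans le_tu)/Hab.
- by move=> a _ Ha w /(le_acc le_tu)/Ha.
Qed.

(** Löb induction along [acc_wf]. The extra assumption [Box phi] at [u] is the diagonal formula in
    the premises of the modal rules. *)
Lemma forces_loeb t phi :
  (forall u, acc t u -> forces u (Box phi) -> forces u phi) ->
  forces t (Box phi).
Proof.
move=> step u; elim/(well_founded_ind acc_wf): u => u IH acc_u.
by apply: step => // w acc_w; apply: IH => //; apply: le_acc acc_w; apply: acc_le.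
Qed.

Definition forces_all t (G : {mset form}) := forall phi, phi \in G -> forces t phi.
Definition forces_opt t D := if D is Some phi then forces t phi else False.
Definition refutes t S :=
  forces_all t (antecedent S) /\ ~ forces_opt t (succedent S).
Definition refutable S := exists t, refutes t S.
Definition valid S :=
  forall t, forces_all t (antecedent S) -> forces_opt t (succedent S).

Lemma forces_allD t A B :
  forces_all t (A `+` B) <-> forces_all t A /\ forces_all t B.
Proof.
split=> [H|[HA HB] phi]; last by rewrite in_msetD => /orP[/HA|/HB].
by split=> phi Hphi; apply: H; rewrite in_msetD Hphi ?orbT.
Qed.

Lemma forces_all1 t phi : forces_all t [mset phi] <-> forces t phi.
Proof.
split=> [|H psi]; last by rewrite in_mset1 => /eqP->.
by apply; rewrite in_mset1.
Qed.

Lemma forces_all_mbox t G :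
  forces_all t (mbox G) <-> forall phi, phi \in G -> forces t (Box phi).
Proof.
split=> H phi => [Gphi|/mem_mbox[psi Gpsi ->]]; last exact: H.
by apply: H; apply/mem_mbox; exists phi.
Qed.

Lemma forces_all_le t u G : le t u -> forces_all t G -> forces_all u G.
Proof. by move=> le_tu H phi /H; apply: forces_le. Qed.

Lemma forces_all_acc t u G :
  acc t u -> forces_all t (mbox G) -> forces_all u (mboxdot G).
Proof.
move=> acc_u HG; rewrite forces_allD; split; last first.
  by apply: forces_all_le HG; apply: acc_le.
by move: HG; rewrite forces_all_mbox => HG phi /HG; apply.
Qed.

Definition forcesE := (forces_allD, forces_all1).

(** * Soundness of both calculi *)

Definition sound_rule (R : calculus) :=
  forall Ps S, R Ps S -> (forall P, List.In P Ps -> valid P) -> valid S.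

Lemma derivable_valid (R : calculus) S :
  sound_rule R -> derivable R S -> valid S.
Proof. by move=> sR; elim=> {}S Ps /sR H _ /H. Qed.

Lemma common_sound : sound_rule common_rule.
Proof.
move=> Ps S [] /=.
- by move=> G p _ t /=; rewrite !forcesE => -[].
- by move=> G D _ t /=; rewrite !forcesE => -[].
- move=> G a b H t /= tG.
  by split; [apply: (H (G ⇒ Some a)) | apply: (H (G ⇒ Some b))]; auto.
- move=> G a b D H t /=; rewrite !forcesE /= => -[tG [ta tb]].
  by apply: (H (G `+` [mset a; b] ⇒ D)); [left|rewrite /= !forcesE].
- by move=> G a b H t /= tG; left; apply: (H (G ⇒ Some a)); auto.
- by move=> G a b H t /= tG; right; apply: (H (G ⇒ Some b)); auto.
- move=> G a b D H t /=; rewrite !forcesE /= => -[tG [ta|tb]].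
    by apply: (H (G `+` [mset a] ⇒ D)); [auto|rewrite /= !forcesE].
  by apply: (H (G `+` [mset b] ⇒ D)); [auto|rewrite /= !forcesE].
- move=> G a b H t /= tG u le_u ua.
  apply: (H (G `+` [mset a] ⇒ Some b)); [auto|rewrite /= !forcesE].
  by split=> //; apply: forces_all_le tG.
Qed.

Lemma G3iSL_sound : sound_rule G3iSL.
Proof.
move=> Ps S [{}Ps {}S|G a b D H t|Sg Pi G a _ H t] /=.
- exact: common_sound.
- rewrite !forcesE => -[tG tab]; have ta : forces t a.
    by apply: (H (G `+` [mset Imp a b] ⇒ Some a)); [by left|rewrite /= !forcesE].
  apply: (H (G `+` [mset b] ⇒ D)); [by right; left|rewrite /= !forcesE; split=> //].
  exact: tab (le_refl t) ta.
- rewrite !forcesE => -[[_ tPi] tG]; apply: forces_loeb => u acc_u ua.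
  apply: (H (Pi `+` mboxdot G `+` [mset Box a] ⇒ Some a)); [by left|].
  rewrite /= (forces_allD u _ [mset _]) forces_allD forces_all1.
  by split=> //; split; [apply: forces_all_le tPi; apply: acc_le|apply: forces_all_acc tG].
Qed.

Lemma G4iSL_sound : sound_rule G4iSL.
Proof.
move=> Ps S [{}Ps {}S|G p a D H t|G a b c D H t|G a b c D H t|G a b c D H t
  |Pi G a b D _ H t|Pi G a _ H t] /=.
- exact: common_sound.
- rewrite !forcesE => -[tG [tp tpa]].
  apply: (H (G `+` [mset Var p; a] ⇒ D)); [by left|rewrite /= !forcesE; split=> //].
  by split=> //; apply: tpa (le_refl t) tp.
- rewrite !forcesE => -[tG tabc].
  apply: (H (G `+` [mset Imp a (Imp b c)] ⇒ D)); [by left|rewrite /= !forcesE; split=> //].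
  move=> u tu ua w uw wb; apply: tabc; first exact: le_trans uw.
  by split=> //; apply: forces_le ua.
- rewrite !forcesE => -[tG tabc].
  apply: (H (G `+` [mset Imp a c; Imp b c] ⇒ D)); [by left|rewrite /= !forcesE; split=> //].
  by split=> u tu Hu; apply: tabc => //; [left|right].
- rewrite !forcesE => -[tG tabc].
  apply: (H (G `+` [mset c] ⇒ D)); [by right; left|rewrite /= !forcesE; split=> //].
  apply: (tabc _ (le_refl t)).
  apply: (H (G `+` [mset Imp b c] ⇒ Some (Imp a b))); [by left|rewrite /= !forcesE; split=> //].
  (* Forcing of [b] persists, so [Imp a b] holds at [u] and the given implication yields [c]. *)
  by move=> u tu ub; apply: tabc => // w uw _; apply: forces_le ub.
- rewrite !forcesE => -[[tPi tG] tab].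
  apply: (H (Pi `+` mbox G `+` [mset b] ⇒ D)); [by right; left|rewrite /= !forcesE; split=> //].
  apply: (tab _ (le_refl t)); apply: forces_loeb => u acc_u ua.
  apply: (H (Pi `+` mboxdot G `+` [mset Box a; Imp (Box a) b] ⇒ Some a)); [by left|].
  have tu := acc_le acc_u.
  rewrite /= (forces_allD u _ [mset _; _]) (forces_allD _ Pi) forces_allD !forces_all1.
  split; first by split; [apply: forces_all_le tPi|apply: forces_all_acc tG].
  by split=> //; apply: (@forces_le t u (Imp (Box a) b)).
- rewrite !forcesE => -[tPi tG]; apply: forces_loeb => u acc_u ua.
  apply: (H (Pi `+` mboxdot G `+` [mset Box a] ⇒ Some a)); [by left|].
  rewrite /= (forces_allD u _ [mset _]) forces_allD forces_all1.
  by split=> //; split; [apply: forces_all_le tPi; apply: acc_le|apply: forces_all_acc tG].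
Qed.

(** * Gluing countermodels *)

(** A lexicographic order; [good] will confine it to sequents over a fixed finite list. The second
    clause takes [<=] instead of equality, so that a step only has to show that the first measure
    does not grow. *)
Definition below (good : sequent -> Prop) (m1 m2 : sequent -> nat) S' S : Prop :=
  good S' /\ ((m1 S' < m1 S)%N \/ (m1 S' <= m1 S)%N /\ (m2 S' < m2 S)%N).

Lemma below_wf good m1 m2 : well_founded (below good m1 m2).
Proof.
suff wf n m S : (m1 S <= n)%N -> (m2 S <= m)%N -> Acc (below good m1 m2) S.
  by move=> S; apply: (wf (m1 S) (m2 S)).
elim: n m S => [|n IHn] m S; elim: m S => [|m IHm] S le1 le2;
  constructor=> S' [_ [lt1|[le1' lt2]]]; try lia.
- by apply: IHm; lia.
(* A drop in the first measure leaves the second unbounded, hence the fresh bound [m2 S']. *)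
- by apply: (IHn (m2 S')); lia.
- by apply: (IHn (m2 S')); lia.
- by apply: IHm; lia.
Qed.

(** A semantic substitute for invertibility: at a stable sequent, every smaller premise whose
    countermodels also refute the conclusion is derivable. *)
Definition stable (R : calculus) (lt : sequent -> sequent -> Prop) S :=
  forall S', lt S' S -> (forall t, refutes t S' -> refutes t S) -> derivable R S'.

(** The interface through which both completeness proofs see the glued model. By the third clause an
    implication of the antecedent can fail only if the root itself forces its left side; the last
    two clauses supply refuting worlds along [le] and along [acc]. *)
Definition is_root (R : calculus) (lt : sequent -> sequent -> Prop) S r :=
  let G := antecedent S in
  [/\ forall p, forces r (Var p) <-> Var p \in G,
      forall a, Box a \in G -> forces r (Box a),
      forall a b, Imp a b \in G -> ~ forces r a -> forces r (Imp a b),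
      forall S', lt S' S -> ~ derivable R S' ->
        (forall t, refutes t S' -> forces_all t G) ->
        exists2 u, le r u & refutes u S'
    & forall S', lt S' S -> ~ derivable R S' ->
        (forall t, refutes t S' ->
           forces_all t G /\ forall a, Box a \in G -> forces t a) ->
        exists2 u, acc r u & refutes u S'].

Lemma root_exists R lt S :
  (forall S', lt S' S -> ~ derivable R S' -> refutable S') ->
  exists r, is_root R lt S r.
Proof.
set G := antecedent S => IH.
(* The children are indexed by the eligible sequents. The boolean marks a strong edge, allowed only
   if the countermodels also force the contents of the boxes in [G]. *)
pose K (x : bool * sequent) := [/\ lt x.2 S, ~ derivable R x.2 &
  forall t, refutes t x.2 ->
    forces_all t G /\ (x.1 -> forall a, Box a \in G -> forces t a)].
have [c cP] : exists c : sig K -> tree, forall j, refutes (c j) (sval j).2.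
  apply: (functional_choice (fun j t => refutes t (sval j).2)).
  by case=> -[b S'] [lt_S' nd_S' _] /=; apply: IH.
pose r := Node (fun p => Var p \in G) (fun j => (sval j).1) c.
have cG j : forces_all (c j) G.
  by have [_ _ KP] := svalP j; have [] := KP _ (cP j).
have le_r u : le r u -> u = r \/ forces_all u G.
  by move=> [<-|[j le_u]]; [left|right; apply: forces_all_le (cG j)].
exists r; split.
- move=> p; split=> [Hp|Gp u le_u]; first exact: (Hp r (le_refl r)).
  by have [->//|uG] := le_r u le_u; apply: (uG (Var p) Gp u (le_refl u)).
- move=> a Ga u [j [[ej le_u]|acc_u]].
    have [_ _ KP] := svalP j; have [_ /(_ ej a Ga)] := KP _ (cP j).
    exact: forces_le.
  exact: (cG j (Box a)).
- move=> a b Gab nra u le_u ua.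
  have [eq_u|uG] := le_r u le_u; first by rewrite eq_u in ua.
  exact: (uG (Imp a b) Gab u (le_refl u)).
- move=> S' lt_S' nd_S' S'G.
  have KS' : K (false, S') by split=> // t /S'G.
  exists (c (exist K _ KS')); last exact: cP (exist K _ KS').
  by right; exists (exist K _ KS'); apply: le_refl.
- move=> S' lt_S' nd_S' S'G.
  have KS' : K (true, S') by split=> // t /S'G [].
  exists (c (exist K _ KS')); last exact: cP (exist K _ KS').
  by exists (exist K _ KS'); left; split=> //; apply: le_refl.
Qed.

Lemma underivable_refutable R good m1 m2 :
  let lt := below good m1 m2 in
  (forall S r, good S -> ~ derivable R S -> stable R lt S -> is_root R lt S r ->
     refutes r S) ->
  forall S, good S -> ~ derivable R S -> refutable S.
Proof.
move=> lt step S; elim/(well_founded_ind (below_wf good m1 m2)): S => S IH gS ndS.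
have IH' S' : lt S' S -> ~ derivable R S' -> refutable S'.
  by move=> lt_S'; apply: IH => //; case: lt_S'.
have [stS|] := classic (stable R lt S).
  by have [r rP] := root_exists IH'; exists r; apply: step.
move=> /not_all_ex_not[S' /not_all_ex_not[lt_S' nst]].
have [t tS'] : refutable S' by apply: IH' => // dS'; apply: nst.
exists t; apply: NNPP => ntS; apply: nst => toS; by case: ntS; apply: toS.
Qed.

Lemma derivable0 (R : calculus) S : R [::] S -> derivable R S.
Proof. by move=> RS; apply: (derivable_by RS). Qed.

Lemma derivable1 (R : calculus) P S : R [:: P] S -> derivable R P -> derivable R S.
Proof. by move=> RS dP; apply: (derivable_by RS) => _ [<-|[]]. Qed.

Lemma derivable2 (R : calculus) P Q S :
  R [:: P; Q] S -> derivable R P -> derivable R Q -> derivable R S.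
Proof. by move=> RS dP dQ; apply: (derivable_by RS) => _ [<-|[<-|[]]]. Qed.

(** * Completeness of G3iSL *)

(** Serves the case of an implication whose left side is already covered: a derivation of [b] from
    [G] must give one of [b] from [G] and [a]. *)
Lemma G3_weakening G D phi :
  derivable G3iSL (G ⇒ D) -> derivable G3iSL (phi +` G ⇒ D).
Proof.
suff wk S : derivable G3iSL S ->
    derivable G3iSL (phi +` antecedent S ⇒ succedent S) by apply: (wk (G ⇒ D)).
elim=> {}S Ps [{}Ps {}S|{}G a b {}D|Sg Pi {}G a nbPi] /=.
- case=> /=.
  + move=> {}G p _ _; rewrite msetDA; exact: derivable0 (G3_common (At _ _)).
  + move=> {}G {}D _ _; rewrite msetDA; exact: derivable0 (G3_common (LBot _ _)).
  + move=> {}G a b _ IH; apply: derivable2 (G3_common (RAnd _ _ _)) _ _.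
      by apply: (IH (G ⇒ Some a)); left.
    by apply: (IH (G ⇒ Some b)); right; left.
  + move=> {}G a b {}D _ IH; rewrite msetDA.
    apply: derivable1 (G3_common (LAnd _ _ _ _)) _; rewrite -msetDA.
    by apply: (IH (G `+` [mset a; b] ⇒ D)); left.
  + move=> {}G a b _ IH; apply: derivable1 (G3_common (ROr0 _ _ _)) _.
    by apply: (IH (G ⇒ Some a)); left.
  + move=> {}G a b _ IH; apply: derivable1 (G3_common (ROr1 _ _ _)) _.
    by apply: (IH (G ⇒ Some b)); left.
  + move=> {}G a b {}D _ IH; rewrite msetDA.
    apply: derivable2 (G3_common (LOr _ _ _ _)) _ _; rewrite -msetDA.
      by apply: (IH (G `+` [mset a] ⇒ D)); left.
    by apply: (IH (G `+` [mset b] ⇒ D)); right; left.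
  + move=> {}G a b _ IH; apply: derivable1 (G3_common (RImp _ _ _)) _.
    by rewrite -msetDA; apply: (IH (G `+` [mset a] ⇒ Some b)); left.
- move=> _ IH; rewrite msetDA; apply: derivable2 (LImp _ _ _ _) _ _; rewrite -msetDA.
    by apply: (IH (G `+` [mset Imp a b] ⇒ Some a)); left.
  by apply: (IH (G `+` [mset b] ⇒ D)); right; left.
(* A boxed formula joins [mbox Sg], which the premise drops; any other formula joins [Pi], which the
   premise keeps. *)
- move=> d IH; case phiB: (boxed phi).
    case: phi phiB {IH} => // c _; rewrite !msetDA -mbox1 -mboxD.
    by apply: derivable1 (RSL _ _ _ nbPi) _; apply: d; left.
  have -> : phi +` (mbox Sg `+` Pi `+` mbox G) = mbox Sg `+` (phi +` Pi) `+` mbox G.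
    by mset_ac.
  apply: derivable1 (RSL _ _ _ _) _.
    by move=> psi; rewrite in_mset1D => /orP[/eqP->|/nbPi]; rewrite ?phiB.
  by rewrite -!msetDA; move: (IH _ (or_introl erefl)); rewrite /= -!msetDA.
Qed.

Lemma G3_identity G phi : phi \in G -> derivable G3iSL (G ⇒ Some phi).
Proof.
elim: phi G => [|p|a IHa b IHb|a IHa b IHb|a IHa b IHb|a IHa] G /mem_mset_split[G0 ->].
- exact: derivable0 (G3_common (LBot _ _)).
- exact: derivable0 (G3_common (At _ _)).
- apply: derivable1 (G3_common (LAnd _ _ _ _)) _.
  apply: derivable2 (G3_common (RAnd _ _ _)) (IHa _ _) (IHb _ _);
    by rewrite !in_msetE eqxx ?orbT.
- apply: derivable2 (G3_common (LOr _ _ _ _)) _ _.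
    by apply: derivable1 (G3_common (ROr0 _ _ _)) (IHa _ _); rewrite !in_msetE eqxx ?orbT.
  by apply: derivable1 (G3_common (ROr1 _ _ _)) (IHb _ _); rewrite !in_msetE eqxx ?orbT.
- apply: derivable1 (G3_common (RImp _ _ _)) _; rewrite msetDAC.
  by apply: derivable2 (LImp _ _ _ _) (IHa _ _) (IHb _ _); rewrite !in_msetE eqxx ?orbT.
(* [Box a] is placed in [mbox G] of the rule with [Sg] empty, so that [mboxdot] puts [a] into the
   premise. *)
- have [Pi [Gm [nbPi ->]]] := box_split G0; rewrite -mbox1 -msetDA -mboxD -(mset0D Pi) -mbox0.
  apply: derivable1 (RSL _ _ _ nbPi) (IHa _ _).
  by rewrite !in_msetE eqxx ?orbT.
Qed.

(** * Covering and the measure for [G3iSL] *)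

Fixpoint sub phi : seq form :=
  phi :: match phi with
         | And a b | Or a b | Imp a b => sub a ++ sub b
         | Box a => sub a
         | _ => [::]
         end.

(* A syntactic approximation of the formulas forced by every world forcing [G]
   that, unlike membership in [G], persists when left rules decompose [G]. *)
Fixpoint covers (G : {mset form}) phi : bool :=
  (phi \in G) ||
  match phi with
  | And a b => covers G a && covers G b
  | Or a b => covers G a || covers G b
  | Imp a b => covers G b
  | _ => false
  end.

Fixpoint size_form phi : nat :=
  match phi with
  | And a b | Or a b | Imp a b => (size_form a + size_form b).+1
  | Box a => (size_form a).+1
  | _ => 0
  end.

Definition weight (w : form -> nat) (G : {mset form}) := \sum_(phi <- G) w phi.

Lemma weightD w A B : weight w (A `+` B) = (weight w A + weight w B)%N.
Proof. by rewrite /weight (perm_big _ (perm_msetD A B)) big_cat. Qed.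

Lemma weight1 w phi : weight w [mset phi] = w phi.
Proof. by rewrite /weight enum_msetn big_seq1. Qed.

Lemma mem_covers G phi : phi \in G -> covers G phi.
Proof. by case: phi => * /=; apply/orP; left. Qed.

Lemma covers_trans G G' phi :
  (forall psi, psi \in G -> covers G' psi) -> covers G phi -> covers G' phi.
Proof.
move=> GG'; elim: phi => [|p|a IHa b IHb|a IHa b IHb|a IHa b IHb|a IHa] /= /orP[/GG'//|] //.
- by move=> /andP[/IHa-> /IHb->]; rewrite orbT.
- by move=> /orP[/IHa->|/IHb->]; rewrite !orbT.
- by move=> /IHb->; rewrite orbT.
Qed.

Lemma count_lt (T : eqType) (a b : pred T) (s : seq T) x :
  subpred a b -> x \in s -> b x -> ~~ a x -> (count a s < count b s)%N.
Proof.
move=> ab; elim: s => //= y s IH; rewrite inE => /orP[/eqP<- bx nax|sx bx nax].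
  by rewrite bx (negbTE nax) /= add0n add1n ltnS sub_count.
have := IH sx bx nax.
suff : (a y <= b y)%N by lia.
by have := ab y; case: (a y); case: (b y) => // /(_ isT).
Qed.

(** Instantiated with [sub] for [G3iSL] and with [boxes] for [G4iSL]; it keeps all sequents of one
    argument inside the same list, whose length bounds the first measure. *)
Definition within (cl : form -> seq form) (U : seq form) S :=
  (forall phi, phi \in antecedent S -> {subset cl phi <= U}) /\
  if succedent S is Some phi then {subset cl phi <= U} else True.

Definition uncovered (U : seq form) S :=
  count (fun chi => ~~ covers (antecedent S) chi) U.

Definition below3 U :=
  below (within sub U) (uncovered U) (fun S => weight size_form (antecedent S)).

Lemma uncovered_le U S S' :
  (forall psi, psi \in antecedent S -> covers (antecedent S') psi) ->
  (uncovered U S' <= uncovered U S)%N.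
Proof. by move=> SS'; apply: sub_count => phi; apply/contra/covers_trans. Qed.

Lemma uncovered_lt U S S' phi :
  (forall psi, psi \in antecedent S -> covers (antecedent S') psi) ->
  phi \in U -> covers (antecedent S') phi -> ~~ covers (antecedent S) phi ->
  (uncovered U S' < uncovered U S)%N.
Proof.
move=> SS' Uphi S'phi nSphi; apply: (@count_lt _ _ _ _ phi) => //; last by rewrite S'phi.
by move=> psi; apply/contra/covers_trans.
Qed.

Lemma sub_refl phi : phi \in sub phi.
Proof. by case: phi => * /=; rewrite inE eqxx. Qed.

(** Derives the premise of a left rule that replaces [c] by [X]: a countermodel of the premise
    forces [X], hence [c], and so refutes the conclusion. *)
Lemma stable_left (R : calculus) (lt : sequent -> sequent -> Prop) G c X D :
  stable R lt (G `+` [mset c] ⇒ D) -> lt (G `+` X ⇒ D) (G `+` [mset c] ⇒ D) ->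
  (forall t, forces_all t X -> forces t c) -> derivable R (G `+` X ⇒ D).
Proof.
move=> st ltX Xc; apply: st ltX _ => t; rewrite /refutes /= !forcesE.
by move=> [[tG tX] ntD]; split=> //; split=> //; apply: Xc.
Qed.

Lemma within_left cl U G c X D :
  within cl U (G `+` [mset c] ⇒ D) ->
  (forall phi, phi \in X -> {subset cl phi <= cl c}) -> within cl U (G `+` X ⇒ D).
Proof.
move=> [gG gD] gX; split=> //= phi; rewrite in_msetD => /orP[Gphi|/gX phic] psi.
  by apply: gG; rewrite in_msetD Gphi.
by move/phic; apply: gG; rewrite in_msetD in_mset1 eqxx orbT.
Qed.

(** Since [c] stays covered, the first measure does not grow, while the size drops. *)
Lemma below3_left U G c X D :
  within sub U (G `+` [mset c] ⇒ D) ->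
  (forall phi, phi \in X -> {subset sub phi <= sub c}) ->
  covers (G `+` X) c -> (weight size_form X < size_form c)%N ->
  below3 U (G `+` X ⇒ D) (G `+` [mset c] ⇒ D).
Proof.
move=> gS gX Xc ltX; split; first exact: within_left gS gX.
right; split=> /=; last by rewrite !weightD weight1; lia.
apply: uncovered_le => psi /=; rewrite in_msetD in_mset1 => /orP[Gpsi|/eqP->//].
by apply: mem_covers; rewrite in_msetD Gpsi.
Qed.

Lemma forces_all2 t a b : forces_all t [mset a; b] <-> forces t a /\ forces t b.
Proof. by rewrite !forcesE. Qed.

(** The last component is the condition for hanging [t] on a strong edge. *)
Lemma refutes_box_premise t Pi Gm X phi :
  refutes t (Pi `+` mboxdot Gm `+` X ⇒ Some phi) -> no_boxed Pi ->
  [/\ forces_all t (Pi `+` mbox Gm), forces_all t X, ~ forces t phi &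
    forall a, Box a \in Pi `+` mbox Gm -> forces t a].
Proof.
move=> [/= /forces_allD[/forces_allD[tPi /forces_allD[tGm tBGm]] tX] nt] nb.
split=> //; first by rewrite forces_allD.
move=> a; rewrite in_msetD => /orP[/nb //|/mem_mbox[b Gmb [->]]]; exact: tGm.
Qed.

Lemma box_mem_split Pi Gm phi : no_boxed Pi ->
  Box phi \in Pi `+` mbox Gm -> phi \in Gm.
Proof. by move=> nb; rewrite in_msetD => /orP[/nb //|/mem_mbox[b Gmb [->]]]. Qed.

Lemma G3_refutes_root U S r :
  within sub U S -> ~ derivable G3iSL S -> stable G3iSL (below3 U) S ->
  is_root G3iSL (below3 U) S r -> refutes r S.
Proof.
case: S => G D gS nd st [/= rV rB rI rle racc].
have [gG gD] := gS.
(* The two halves need each other: an implication in [G] is forced because its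
   antecedent is refuted, and [a -> b] with [a] covered is refuted at the root
   itself because [a] is forced there. *)
have covered_or_refuted chi : {subset sub chi <= U} ->
    (covers G chi -> forces r chi) /\
    (~ derivable G3iSL (G ⇒ Some chi) -> ~ forces r chi).
  elim: chi => [|p|a IHa b IHb|a IHa b IHb|a IHa b IHb|a IHa] /= Uchi.
  - split=> [|_ //] /orP[/mem_mset_split[G0 eqG]|//]; case: nd; rewrite eqG.
    exact: derivable0 (G3_common (LBot _ _)).
  - split=> [/orP[Gp|//]|ndp]; first exact/rV.
    by move/rV/G3_identity.
  - have [|Ca Da] := IHa; first by move=> x xa; apply: Uchi; rewrite inE mem_cat xa orbT.
    have [|Cb Db] := IHb; first by move=> x xb; apply: Uchi; rewrite inE mem_cat xb !orbT.
    split=> [/orP[/mem_mset_split[G0 eqG]|/andP[/Ca ? /Cb]//]|ndab].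
      (* A conjunction cannot occur in the antecedent: stability would derive the premise of [LAnd].
         Disjunctions are excluded below in the same way. *)
      case: nd; subst G; apply: derivable1 (G3_common (LAnd _ _ _ _)) _.
      apply: (stable_left st); last by move=> t /forces_all2.
      apply: below3_left => //.
      + by move=> phi /mset2P[]-> x Hx; rewrite inE mem_cat Hx ?orbT.
      + rewrite /=; apply/orP; right; rewrite !mem_covers //;
          by rewrite !in_msetD !in_mset1 eqxx ?orbT.
      + by rewrite weightD !weight1 /=; lia.
    move=> [ra rb]; apply: ndab.
    apply: derivable2 (G3_common (RAnd _ _ _)) _ _; apply: NNPP; by [move/Da|move/Db].
  - have [|Ca Da] := IHa; first by move=> x xa; apply: Uchi; rewrite inE mem_cat xa orbT.
    have [|Cb Db] := IHb; first by move=> x xb; apply: Uchi; rewrite inE mem_cat xb !orbT.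
    split=> [/orP[/mem_mset_split[G0 eqG]|/orP[/Ca|/Cb]]|ndab]; [|by left|by right|].
      case: nd; subst G; apply: derivable2 (G3_common (LOr _ _ _ _)) _ _.
      + apply: (stable_left st); last by move=> t /forces_all1; left.
        apply: below3_left => //.
        * by move=> phi; rewrite in_mset1 => /eqP-> x Hx; rewrite inE mem_cat Hx ?orbT.
        * by rewrite /=; apply/orP; right; rewrite mem_covers // in_msetD in_mset1 eqxx orbT.
        * by rewrite weight1 /=; lia.
      + apply: (stable_left st); last by move=> t /forces_all1; right.
        apply: below3_left => //.
        * by move=> phi; rewrite in_mset1 => /eqP-> x Hx; rewrite inE mem_cat Hx ?orbT.
        * by rewrite /=; apply/orP; right; rewrite orbC mem_covers // in_msetD in_mset1 eqxx orbT.
        * by rewrite weight1 /=; lia.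
    move=> [/Da|/Db]; apply=> d; apply: ndab.
      exact: derivable1 (G3_common (ROr0 _ _ _)) d.
    exact: derivable1 (G3_common (ROr1 _ _ _)) d.
  - have Ua : {subset sub a <= U} by move=> x xa; apply: Uchi; rewrite inE mem_cat xa orbT.
    have Ub : {subset sub b <= U} by move=> x xb; apply: Uchi; rewrite inE mem_cat xb !orbT.
    have [Ca Da] := IHa Ua; have [Cb Db] := IHb Ub.
    split=> [/orP[Gab|/Cb rb]|ndab]; last 1 first.
    + have [Ga|nGa] := boolP (covers G a).
        move=> /(_ r (le_refl r) (Ca Ga)); apply: Db => d; apply: ndab.
        apply: derivable1 (G3_common (RImp _ _ _)) _; rewrite msetDC.
        exact: G3_weakening.
      (* With [a] uncovered, adding it to the antecedent gives a smaller sequent, and a world above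
         the root refutes it. *)
      have [||t [/=]|u le_u [/= /forces_allD[_ /forces_all1 ua] nub] rab] :=
          rle (G `+` [mset a] ⇒ Some b).
      * split; first split=> //= phi.
          by rewrite in_msetD in_mset1 => /orP[/gG|/eqP->].
        left; apply: (@uncovered_lt _ _ _ a) => //=; first 1 last.
        -- exact/Ua/sub_refl.
        -- by apply: mem_covers; rewrite in_msetD in_mset1 eqxx orbT.
        -- by move=> psi Gpsi; apply: mem_covers; rewrite in_msetD Gpsi.
      * by move=> d; apply: ndab; apply: derivable1 (G3_common (RImp _ _ _)) d.
      * by move=> /forces_allD[].
      * by apply: nub; apply: rab.
    (* The left premise of [LImp] keeps the implication, so it is the sequent from [G] to [a]. The
       right premise is derivable by stability, hence the left one is not and the root refutes
       [a]. *)
    + apply: rI => //; apply: Da => da; apply: nd.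
      have [G0 eqG] := mem_mset_split Gab; subst G.
      apply: derivable2 (LImp _ _ _ _) da _.
      apply: (stable_left st); last by move=> t /forces_all1 tb u tu _; apply: forces_le tb.
      apply: below3_left => //.
      * by move=> phi; rewrite in_mset1 => /eqP-> x Hx; rewrite inE mem_cat Hx !orbT.
      * by rewrite /=; apply/orP; right; rewrite mem_covers // in_msetD in_mset1 eqxx orbT.
      * by rewrite weight1 /=; lia.
    + by move=> u le_u _; apply: forces_le rb.
  - split=> [/orP[Ga|//]|ndB]; first exact: rB.
    have [Pi [Gm [nbPi eqG]]] := box_split G; subst G.
    have ndP : ~ derivable G3iSL (Pi `+` mboxdot Gm `+` [mset Box a] ⇒ Some a).
      by move=> d; apply: ndB; rewrite -(mset0D Pi) -mbox0; apply: derivable1 (RSL _ _ _ nbPi) d.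
    have nGa : Box a \notin Pi `+` mbox Gm by apply/negP => /G3_identity.
    have [|t /refutes_box_premise/(_ nbPi)[]//|u acc_u /refutes_box_premise] := racc _ _ ndP.
      split; first split=> /= [phi|].
      + rewrite msetDA in_msetD in_mset1 in_msetD => /orP[/orP[]|/eqP->//].
          rewrite in_msetD => /orP[Piphi|Gmphi] x Hx.
            by apply: (gG phi) => //; rewrite in_msetD Piphi.
          apply: (gG (Box phi)); last by rewrite inE Hx orbT.
          by rewrite in_msetD; apply/orP; right; apply/mem_mbox; exists phi.
        by move=> Gmphi; apply: gG; rewrite in_msetD Gmphi orbT.
      + by move=> x Hx; apply: Uchi; rewrite inE Hx orbT.
      (* A box is covered only by membership, so [Box a] is newly covered in the premise. *)
      + left; apply: (@uncovered_lt _ _ _ (Box a)) => //=.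
        * move=> psi Gpsi; apply: mem_covers; move: Gpsi.
          by rewrite !in_msetD => /orP[]->; rewrite ?orbT.
        * exact/Uchi/sub_refl.
        * by rewrite in_msetD in_mset1 eqxx orbT.
        * by rewrite orbF.
    by move=> /(_ nbPi)[_ _ nua _] /(_ u acc_u).
split=> [phi Gphi|] /=.
  by apply: (covered_or_refuted phi (gG _ Gphi)).1; apply: mem_covers.
move: gD nd; clear -covered_or_refuted; case: D => [chi gchi|_ _ []] /=.
by case: (covered_or_refuted chi gchi) => _; apply.
Qed.

Definition universe (cl : form -> seq form) S :=
  flatten [seq cl phi | phi <- (antecedent S : seq form)] ++
  oapp cl [::] (succedent S).

Lemma within_universe cl S : within cl (universe cl S) S.
Proof.
split=> [phi Sphi x Hx|]; rewrite /universe.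
  by rewrite mem_cat; apply/orP; left; apply/flattenP; exists (cl phi); rewrite ?map_f.
by case: (succedent S) => //= phi x Hx; rewrite mem_cat Hx orbT.
Qed.

Lemma valid_G3iSL S : valid S -> derivable G3iSL S.
Proof.
move=> vS; apply: NNPP => ndS.
have [|t [tS]] := underivable_refutable (@G3_refutes_root (universe sub S)) _ ndS.
  exact: within_universe.
by apply; apply: vS.
Qed.

(** * Completeness of G4iSL *)

(* The context [K], present in every derivation of [D] from [b], absorbs the
   second conjunct in the step for [a /\ c]. *)
Lemma G4_identity_mp a :
  (forall G, a \in G -> derivable G4iSL (G ⇒ Some a)) /\
  (forall K b D, (forall G, derivable G4iSL (G `+` K `+` [mset b] ⇒ D)) ->
   forall G, derivable G4iSL (G `+` K `+` [mset a; Imp a b] ⇒ D)).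
Proof.
elim: a => [|p|a [ida mpa] c [idc mpc]|a [ida mpa] c [idc mpc]
  |a [ida mpa] c [idc mpc]|a [ida _]].
- have id G : Bot \in G -> forall D, derivable G4iSL (G ⇒ D).
    by move=> /mem_mset_split[G0 ->] D; apply: derivable0 (G4_common (LBot _ _)).
  split=> [G /id //|K b D _ G]; apply: id.
  by rewrite !in_msetE eqxx ?orbT.
- split=> [G /mem_mset_split[G0 ->]|K b D db G].
    exact: derivable0 (G4_common (At _ _)).
  apply: derivable1 (LVarImp _ _ _ _) _.
  have -> : G `+` K `+` [mset Var p; b] = G `+` [mset Var p] `+` K `+` [mset b] by mset_ac.
  exact: db.
- split=> [G /mem_mset_split[G0 ->]|K b D db G].
    apply: derivable1 (G4_common (LAnd _ _ _ _)) _.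
    by apply: derivable2 (G4_common (RAnd _ _ _)) (ida _ _) (idc _ _);
      rewrite !in_msetE eqxx ?orbT.
  have -> : G `+` K `+` [mset And a c; Imp (And a c) b] =
    G `+` K `+` [mset Imp (And a c) b] `+` [mset And a c] by mset_ac.
  apply: derivable1 (G4_common (LAnd _ _ _ _)) _; rewrite msetDAC.
  apply: derivable1 (LAndImp _ _ _ _ _) _.
  have -> : G `+` K `+` [mset a; c] `+` [mset Imp a (Imp c b)] =
    G `+` (K `+` [mset c]) `+` [mset a; Imp a (Imp c b)] by mset_ac.
  apply: mpa => G'.
  have -> : G' `+` (K `+` [mset c]) `+` [mset Imp c b] = G' `+` K `+` [mset c; Imp c b].
    by mset_ac.
  exact: mpc.
- split=> [G /mem_mset_split[G0 ->]|K b D db G].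
    apply: derivable2 (G4_common (LOr _ _ _ _)) _ _.
      by apply: derivable1 (G4_common (ROr0 _ _ _)) (ida _ _); rewrite !in_msetE eqxx ?orbT.
    by apply: derivable1 (G4_common (ROr1 _ _ _)) (idc _ _); rewrite !in_msetE eqxx ?orbT.
  have -> : G `+` K `+` [mset Or a c; Imp (Or a c) b] =
    G `+` K `+` [mset Imp (Or a c) b] `+` [mset Or a c] by mset_ac.
  apply: derivable2 (G4_common (LOr _ _ _ _)) _ _; rewrite msetDAC;
    apply: derivable1 (LOrImp _ _ _ _ _) _.
    have -> : G `+` K `+` [mset a] `+` [mset Imp a b; Imp c b] =
      G `+` [mset Imp c b] `+` K `+` [mset a; Imp a b] by mset_ac.
    exact: mpa.
  have -> : G `+` K `+` [mset c] `+` [mset Imp a b; Imp c b] =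
    G `+` [mset Imp a b] `+` K `+` [mset c; Imp c b] by mset_ac.
  exact: mpc.
- have id G : Imp a c \in G -> derivable G4iSL (G ⇒ Some (Imp a c)).
    move=> /mem_mset_split[G0 ->]; apply: derivable1 (G4_common (RImp _ _ _)) _.
    (* Identity for an implication is modus ponens for its left side, with empty [K]. *)
    have -> : G0 `+` [mset Imp a c] `+` [mset a] = G0 `+` mset0 `+` [mset a; Imp a c].
      by mset_ac.
    by apply: mpa => G'; apply: idc; rewrite !in_msetE eqxx ?orbT.
  split=> // K b D db G.
  have -> : G `+` K `+` [mset Imp a c; Imp (Imp a c) b] =
    G `+` K `+` [mset Imp a c] `+` [mset Imp (Imp a c) b] by mset_ac.
  apply: derivable2 (LImpImp _ _ _ _ _) (id _ _) _.
    by rewrite !in_msetE eqxx ?orbT.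
  by rewrite (msetDAC G); apply: db.
- split=> [G /mem_mset_split[G0 ->]|K b D db G].
    have [Pi [Gm [nbPi ->]]] := box_split G0; rewrite -mbox1 -msetDA -mboxD.
    apply: derivable1 (R4SL _ _ nbPi) (ida _ _).
    by rewrite !in_msetE eqxx ?orbT.
  (* [Box a] joins the boxed part, so the first premise of [ImpSL] contains [a] and is an
     identity. *)
  have [Pi [Gm [nbPi eqGK]]] := box_split (G `+` K).
  rewrite msetDA eqGK -[_ `+` mbox Gm `+` _]msetDA -mbox1 -mboxD.
  apply: derivable2 (ImpSL _ _ _ _ nbPi) (ida _ _) _.
    by rewrite !in_msetE eqxx ?orbT.
  by rewrite mboxD mbox1 msetDA -eqGK (msetDAC G).
Qed.

Lemma G4_identity G phi : phi \in G -> derivable G4iSL (G ⇒ Some phi).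
Proof. by case: (G4_identity_mp phi) => id _; apply: id. Qed.

(** * The measure for [G4iSL] *)

(** An entry [a] stands for the subformula [Box a]. The left implication rules create formulas that
    are not subformulas, such as [Imp a (Imp b c)], but no new boxed ones, so this list replaces
    [sub]. *)
Fixpoint boxes phi : seq form :=
  match phi with
  | And a b | Or a b | Imp a b => boxes a ++ boxes b
  | Box a => a :: boxes a
  | _ => [::]
  end.

(* A conjunction weighs two so that [a -> (b -> c)] is lighter than [a /\ b -> c]. *)
Fixpoint dweight phi : nat :=
  match phi with
  | And a b => (dweight a + dweight b).+2
  | Or a b | Imp a b => (dweight a + dweight b).+1
  | Box a => (dweight a).+1
  | _ => 0
  end.

(* Base 4 makes a formula outweigh any three formulas of smaller weight, which
   is the most that a non-modal step puts in its place. *)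
Definition pow4 phi := 4 ^ dweight phi.

(** The succedent counts, because right premises are compared as sequents; for [G3iSL] an induction
    on formulas deals with the right side. *)
Definition weight4 S := (weight pow4 (antecedent S) + oapp pow4 0 (succedent S))%N.

Definition missing_boxes (U : seq form) S :=
  count (fun chi => Box chi \notin antecedent S) U.

Definition below4 U := below (within boxes U) (missing_boxes U) weight4.

Lemma pow4_lt a b c phi :
  (dweight a < dweight phi)%N -> (dweight b < dweight phi)%N ->
  (dweight c < dweight phi)%N -> (pow4 a + pow4 b + pow4 c < pow4 phi)%N.
Proof.
rewrite /pow4; case: (dweight phi) => // w; rewrite !ltnS => aw bw cw.
have := leq_pexp2l (isT : 0 < 4) aw; have := leq_pexp2l (isT : 0 < 4) bw.
have := leq_pexp2l (isT : 0 < 4) cw; have : 0 < 4 ^ w by rewrite expn_gt0.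
by rewrite expnS; lia.
Qed.

Lemma pow4_lt2 a b phi :
  (dweight a < dweight phi)%N -> (dweight b < dweight phi)%N ->
  (pow4 a + pow4 b < pow4 phi)%N.
Proof. by move=> aw bw; have := pow4_lt aw bw bw; lia. Qed.

Lemma pow4_lt1 a phi : (dweight a < dweight phi)%N -> (pow4 a < pow4 phi)%N.
Proof. by move=> aw; have := pow4_lt aw aw aw; lia. Qed.

Lemma below4_weight U S S' :
  within boxes U S' ->
  (forall a, Box a \in antecedent S -> Box a \in antecedent S') ->
  (weight4 S' < weight4 S)%N -> below4 U S' S.
Proof.
move=> gS' SS' ltS; split=> //; right; split=> //.
by apply: sub_count => chi; apply/contra/SS'.
Qed.

Lemma below4_left U G c X D :
  within boxes U (G `+` [mset c] ⇒ D) ->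
  (forall phi, phi \in X -> {subset boxes phi <= boxes c}) ->
  ~~ boxed c -> (weight pow4 X < pow4 c)%N ->
  below4 U (G `+` X ⇒ D) (G `+` [mset c] ⇒ D).
Proof.
move=> gS gX nbc ltX; apply: below4_weight; first exact: within_left gS gX.
  move=> a /=; rewrite !in_msetD in_mset1 => /orP[->//|/eqP eq_c].
  by rewrite -eq_c in nbc.
by rewrite /weight4 /= !weightD weight1; lia.
Qed.

Lemma below4_right U G c d :
  within boxes U (G ⇒ Some c) -> {subset boxes d <= boxes c} ->
  (dweight d < dweight c)%N -> below4 U (G ⇒ Some d) (G ⇒ Some c).
Proof.
move=> [gG gc] dc ltd; apply: below4_weight => //.
  by split=> //= x /dc/gc.
by rewrite /weight4 /= ltn_add2l pow4_lt1.
Qed.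

(** [Box a] is new in the antecedent, so the first measure drops however much the weight grows. The
    context [X] is the principal implication for [ImpSL] and empty for [R4SL]. *)
Lemma below4_box U Pi Gm X a D :
  within boxes U (Pi `+` mbox Gm `+` X ⇒ D) -> a \in U -> {subset boxes a <= U} ->
  Box a \notin Pi `+` mbox Gm `+` X ->
  below4 U (Pi `+` mboxdot Gm `+` (Box a +` X) ⇒ Some a) (Pi `+` mbox Gm `+` X ⇒ D).
Proof.
move=> [/= gG _] Ua Ua' nGa; split; first split=> //= phi.
  rewrite /mboxdot !in_msetD => /orP[/orP[Piphi|/orP[Gmphi|Gmphi]]|/orP[]].
  - by apply: gG; rewrite !in_msetD Piphi.
  - move=> x Hx; apply: (gG (Box phi)); last by rewrite inE Hx orbT.
    rewrite !in_msetD; apply/orP; left; apply/orP; right; apply/mem_mbox; by exists phi.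
  - by apply: gG; rewrite !in_msetD Gmphi orbT.
  - by rewrite in_mset1 => /eqP-> x; rewrite inE => /orP[/eqP->|/Ua'].
  - by move=> Xphi; apply: gG; rewrite in_msetD Xphi orbT.
left; apply: (@count_lt _ _ _ _ a) => //=.
  move=> chi; apply: contra; rewrite !in_msetD.
  by move=> /orP[/orP[]|]->; rewrite ?orbT.
by rewrite negbK !in_msetD in_mset1 eqxx orbT.
Qed.

Ltac mset1_subset :=
  move=> ?; rewrite in_mset1 => /eqP-> ?;
  rewrite /= ?mem_cat => ->; by rewrite ?orbT.

(** A case analysis on the shape of the formula, and for an implication in the antecedent on the
    shape of its left side, takes the place of the induction used for [G3iSL]. *)
Lemma G4_refutes_root U S r :
  within boxes U S -> ~ derivable G4iSL S -> stable G4iSL (below4 U) S ->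
  is_root G4iSL (below4 U) S r -> refutes r S.
Proof.
case: S => G D gS nd st [rV rB rI rle racc].
split=> [phi Gphi|].
  have [G0 eqG] := mem_mset_split Gphi; move: Gphi; simpl in eqG; subst G => Gphi.
  case: phi => [|p|a b|a b|a b|a] in gS nd st rV rB rI rle racc Gphi *.
  - by case: nd; apply: derivable0 (G4_common (LBot _ _)).
  - exact/rV.
  - case: nd; apply: derivable1 (G4_common (LAnd _ _ _ _)) _.
    apply: (stable_left st); last by move=> t /forces_all2.
    apply: below4_left => //.
    + by move=> phi /mset2P[]-> x Hx; rewrite /= mem_cat Hx ?orbT.
    + by rewrite weightD !weight1; apply: pow4_lt2; rewrite /=; lia.
  - case: nd; apply: derivable2 (G4_common (LOr _ _ _ _)) _ _.
      apply: (stable_left st); last by move=> t /forces_all1; left.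
      apply: below4_left => //; first by mset1_subset.
      by rewrite weight1; apply: pow4_lt1; rewrite /=; lia.
    apply: (stable_left st); last by move=> t /forces_all1; right.
    apply: below4_left => //; first by mset1_subset.
    by rewrite weight1; apply: pow4_lt1; rewrite /=; lia.
  (* Shared by [LVarImp], [LImpImp] and [ImpSL]: [b] forces [Imp a b], so stability applies. *)
  - have right_premise : derivable G4iSL (G0 `+` [mset b] ⇒ D).
      apply: (stable_left st).
        apply: below4_left => //; first by mset1_subset.
        by rewrite weight1; apply: pow4_lt1; rewrite /=; lia.
      by move=> t /forces_all1 tb u tu _; apply: forces_le tb.
    case: a => [|p|a c|a c|a c|a] in gS nd st rV rB rI rle racc Gphi *.
    + by apply: rI.
    + apply: rI => // /rV; rewrite in_msetD in_mset1 orbF => /mem_mset_split[G1 eqG0].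
      apply: nd; rewrite eqG0 -msetDA; apply: derivable1 (LVarImp _ _ _ _) _.
      by rewrite msetDA -eqG0.
    + case: nd; apply: derivable1 (LAndImp _ _ _ _ _) _.
      apply: (stable_left st); last first.
        move=> t /forces_all1 tacb u tu [ua uc].
        exact: (tacb u tu ua u (le_refl u) uc).
      apply: below4_left => //.
        by move=> phi; rewrite in_mset1 => /eqP-> x; rewrite /= !mem_cat orbA.
      by rewrite weight1; apply: pow4_lt1; rewrite /=; lia.
    + case: nd; apply: derivable1 (LOrImp _ _ _ _ _) _.
      apply: (stable_left st); last first.
        by move=> t /forces_all2[tab tcb] u tu [/(tab u tu)|/(tcb u tu)].
      apply: below4_left => //.
        move=> phi /mset2P[]-> x; rewrite /= !mem_cat => /orP[]->; by rewrite ?orbT.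
      by rewrite weightD !weight1; apply: pow4_lt2; rewrite /=; lia.
    + apply: rI => // rac; apply: nd.
      apply: derivable2 (LImpImp _ _ _ _ _) _ right_premise.
      (* Unfolding the succedent at once gives a sequent whose refuting world forces [a] and not
         [c], against [Imp a c] at the root. Here three formulas replace one, which base 4
         allows. *)
      apply: derivable1 (G4_common (RImp _ _ _)) _; apply: NNPP => ndl.
      have [||u le_u [/= /forces_allD[_ /forces_all1 ua] nuc]] := rle _ _ ndl.
      * apply: below4_weight.
        -- case: gS => /= gG _.
           have gacb : {subset boxes (Imp (Imp a c) b) <= U} by apply: gG.
           split=> /= [phi|x xc]; last by apply: gacb; rewrite /= !mem_cat xc ?orbT.
           rewrite !in_msetD !in_mset1 => /orP[/orP[Gphi0|/eqP->]|/eqP->] x Hx.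
           ++ by apply: (gG phi) => //; rewrite in_msetD Gphi0.
           ++ by apply: gacb; move: Hx; rewrite /= !mem_cat => /orP[]->; rewrite ?orbT.
           ++ by apply: gacb; rewrite /= !mem_cat Hx.
        -- by move=> d /=; rewrite !in_msetD !in_mset1 orbF => ->.
        -- rewrite /weight4 /= !weightD !weight1.
           suff : (pow4 (Imp c b) + pow4 a + pow4 c < pow4 (Imp (Imp a c) b))%N by lia.
           by apply: pow4_lt; rewrite /=; lia.
      * move=> t [/= /forces_allD[/forces_allD[tG /forces_all1 tcb] /forces_all1 ta] _].
        (* As [a] is forced at [t], a later world forcing [Imp a c] forces [c], hence [b]. *)
        apply/forces_allD; split=> //; apply/forces_all1 => u tu uac.
        by apply: tcb => //; apply: uac (le_refl u) _; apply: forces_le ta.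
      * by apply: nuc; apply: rac.
    + apply: rI => // ra; apply: nd.
      have [Pi [Gm [nbPi eqG]]] := box_split G0; subst G0.
      apply: derivable2 (ImpSL _ _ _ _ nbPi) _ right_premise; apply: NNPP => ndl.
      have nGa : Box a \notin Pi `+` mbox Gm `+` [mset Imp (Box a) b].
        apply/negP; rewrite in_msetD in_mset1 orbF => /(box_mem_split nbPi) Gma.
        by apply: ndl; apply: G4_identity; rewrite !in_msetD Gma !orbT.
      have gab : {subset boxes (Imp (Box a) b) <= U} by case: gS => gG _; apply: gG.
      have [||u acc_u /refutes_box_premise/(_ nbPi)[_ _ nua _]] := racc _ _ ndl.
      * apply: below4_box => //; first by apply: gab; rewrite /= inE eqxx.
        by move=> x Hx; apply: gab; rewrite /= inE mem_cat Hx orbT.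
      * move=> t /refutes_box_premise/(_ nbPi)[tG /forces_all2[_ tab] _ tu].
        split; first by apply/forces_allD; split=> //; apply/forces_all1.
        by move=> d; rewrite in_msetD in_mset1 orbF; apply: tu.
      * by apply: nua; apply: ra.
  - exact: rB.
case: D => [chi|] in gS nd st rV rB rI rle racc *; last by [].
case: chi => [|p|a b|a b|a b|a] in gS nd st rV rB rI rle racc *; move=> /= rchi //.
- by apply: nd; apply: G4_identity; apply/rV.
- have [ra rb] := rchi; apply: nd; apply: derivable2 (G4_common (RAnd _ _ _)) _ _.
    apply: st; last by move=> t [tG nta]; split=> // -[].
    by apply: below4_right => //= [x Hx|]; [rewrite mem_cat Hx|lia].
  apply: st; last by move=> t [tG nta]; split=> // -[].
  by apply: below4_right => //= [x Hx|]; [rewrite mem_cat Hx orbT|lia].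
(* A countermodel of one disjunct need not refute the disjunction, so stability is of no help; the
   refuting world comes from the gluing, against persistence from the root. *)
- case: rchi => [ra|rb]; apply: nd.
    apply: derivable1 (G4_common (ROr0 _ _ _)) _; apply: NNPP => nda.
    have [|t []//|u le_u [_ nua]] := rle _ _ nda.
      by apply: below4_right => //= [x Hx|]; [rewrite mem_cat Hx|lia].
    by apply: nua; apply: forces_le ra.
  apply: derivable1 (G4_common (ROr1 _ _ _)) _; apply: NNPP => ndb.
  have [|t []//|u le_u [_ nub]] := rle _ _ ndb.
    by apply: below4_right => //= [x Hx|]; [rewrite mem_cat Hx orbT|lia].
  by apply: nub; apply: forces_le rb.
- apply: nd; apply: derivable1 (G4_common (RImp _ _ _)) _.
  apply: st; last first.
    move=> t [/= /forces_allD[tG /forces_all1 ta] ntb]; split=> // tab.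
    by apply: ntb; apply: tab (le_refl t) ta.
  case: gS => /= gG gab; apply: below4_weight.
  + split=> /= [phi|x Hx]; last by apply: gab; rewrite mem_cat Hx orbT.
    rewrite in_msetD in_mset1 => /orP[/gG//|/eqP->] x Hx.
    by apply: gab; rewrite mem_cat Hx.
  + by move=> d /=; rewrite in_msetD => ->.
  + rewrite /weight4 /= weightD weight1.
    suff : (pow4 a + pow4 b < pow4 (Imp a b))%N by lia.
    by apply: pow4_lt2; rewrite /=; lia.
- apply: nd; have [Pi [Gm [nbPi eqG]]] := box_split G; simpl in eqG; subst G.
  apply: derivable1 (R4SL _ _ nbPi) _; apply: NNPP => ndl.
  have nGa : Box a \notin Pi `+` mbox Gm.
    apply/negP => /(box_mem_split nbPi) Gma.
    by apply: ndl; apply: G4_identity; rewrite !in_msetD Gma !orbT.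
  have [||u acc_u /refutes_box_premise/(_ nbPi)[_ _ nua _]] := racc _ _ ndl.
  + case: gS => gG gBa.
    rewrite -(msetD0 (Pi `+` mbox Gm)) -(msetD0 [mset Box a]).
    apply: below4_box; rewrite ?msetD0 //.
      by apply: gBa; rewrite /= inE eqxx.
    by move=> x Hx; apply: gBa; rewrite /= inE Hx orbT.
  + by move=> t /refutes_box_premise/(_ nbPi)[tG _ _ tu].
  + by apply: nua; apply: rchi.
Qed.

Lemma valid_G4iSL S : valid S -> derivable G4iSL S.
Proof.
move=> vS; apply: NNPP => ndS.
have [|t [tS]] := underivable_refutable (@G4_refutes_root (universe boxes S)) _ ndS.
- exact: within_universe.
- by apply; apply: vS.
Qed.

Theorem theorem3 (S : sequent) : derivable G3iSL S <-> derivable G4iSL S.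
Proof.
split=> [/(derivable_valid G3iSL_sound)|/(derivable_valid G4iSL_sound)].
  exact: valid_G4iSL.
exact: valid_G3iSL.
Qed.
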